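(* Let $K$ be a set and let $\mathsf{C}$ be a partializable Markov category admitting Kolmogorov products of size $K$. (1) Given a family of objects $(X_k)_{k\in K}$ of $\mathsf{C}$, the images in $\mathsf{Partial}(\mathsf{C})$ of the Kolmogorov product projections $\pi_F\colon X^K\to X^F$ of $\mathsf{C}$ define a lax Kolmogorov product of $(X_k)_{k\in K}$ in $\mathsf{Partial}(\mathsf{C})$. (2) A $K$-indexed family of morphisms $(u_k)_{k\in K}=\bigl(X_k\xleftarrow{i_k}D_k\xrightarrow{f_k}Y_k\bigr)_{k\in K}$ of $\mathsf{Partial}(\mathsf{C})$ induces a morphism $\bigotimes_{k\in K}X_k\to\bigotimes_{k\in K}Y_k$ (that is: the morphisms $u^F\circ\pi_F\colon X^K\to Y^F$, $F\subseteq K$ finite, $u^F:=\bigotimes_{k\in F}u_k$, form a lax cone over $F\mapsto Y^F$, and this is the morphism $X^K\to Y^K$ induced by the lax Kolmogorov product $Y^K$). This morphism is represented by $$\bigotimes_{k\in K}X_k\xleftarrow{\bigotimes_{k}i_k}\bigotimes_{k\in K}D_k\xrightarrow{\bigotimes_{k}f_k}\bigotimes_{k\in K}Y_k,$$ where these infinite tensor products of morphisms are taken in $\mathsf{C}$. (3) The infinite copy $u^{(K)}\colon X\to Y^K$ of a morphism $u=\bigl(X\xleftarrow{i}D\xrightarrow{f}Y\bigr)$ of $\mathsf{Partial}(\mathsf{C})$ is represented by $\bigl(X\xleftarrow{i}D\xrightarrow{f^{(K)}}Y^K\bigr)$.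
   Context: A CD category is a symmetric monoidal category $(\mathsf{C},\otimes,I)$ in which every object $X$ carries a commutative comonoid structure $\mathrm{copy}_X\colon X\to X\otimes X$, $\mathrm{del}_X\colon X\to I$, compatible with tensor products ($\mathrm{copy}_{X\otimes Y}$ is $\mathrm{copy}_X\otimes\mathrm{copy}_Y$ followed by swapping the two middle factors, and $\mathrm{del}_{X\otimes Y}=\mathrm{del}_X\otimes\mathrm{del}_Y$) and with $\mathrm{copy}_I=\mathrm{del}_I=\mathrm{id}_I$; coherence isomorphisms are suppressed. A morphism $f\colon X\to Y$ is total if $\mathrm{del}_Y\circ f=\mathrm{del}_X$, copyable if $\mathrm{copy}_Y\circ f=(f\otimes f)\circ\mathrm{copy}_X$, deterministic if it is both, and quasi-total if $(f\otimes(\mathrm{del}_Y\circ f))\circ\mathrm{copy}_X=f$. A Markov category is a CD category in which every morphism is total; a quasi-Markov category is a CD category in which every morphism is quasi-total. In a quasi-Markov category the hom-sets are partially ordered: for $f,g\colon A\to X$, $g\le f$ means $(f\otimes(\mathrm{del}_X\circ g))\circ\mathrm{copy}_A=g$. A Markov category is positive if for all $u\colon X\to Y$, $v\colon Y\to Z$ with $v\circ u$ deterministic, $(u\otimes (v\circ u))\circ\mathrm{copy}_X=(\mathrm{id}_Y\otimes v)\circ\mathrm{copy}_Y\circ u$. Let $(X_k)_{k\in K}$ be a family of objects of a quasi-Markov category. Let $\mathsf{FinSub}(K)$ be the poset of finite subsets of $K$. There is a diagram $X^{(-)}\colon\mathsf{FinSub}(K)^{\mathrm{op}}\to\mathsf{C}$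 with $X^F:=\bigotimes_{k\in F}X_k$, sending $G\subseteq F$ to the marginalization $\pi_{F,G}\colon X^F\to X^G$ (deleting the factors not in $G$). A (strict) Kolmogorov product is a limit cone $(\pi_F\colon X^K\to X^F)_{F}$ of this diagram with all $\pi_F$ deterministic, preserved by $Y\otimes(-)$ for every object $Y$; we write $X^K=\bigotimes_{k\in K}X_k$. In a Markov category with Kolmogorov products of size $K$ (i.e. every $K$-indexed family has one), a family $(f_k\colon X_k\to Y_k)_{k\in K}$ has an infinite tensor $\bigotimes_k f_k\colon X^K\to Y^K$, the unique morphism with $\pi_F\circ\bigotimes_kf_k=(\bigotimes_{k\in F}f_k)\circ\pi_F$ for all finite $F$. A lax cone over $X^{(-)}$ is an object $A$ with morphisms $f_F\colon A\to X^F$ ($F\subseteq K$ finite) such that $\pi_{F,G}\circ f_F\le f_G$ for all $G\subseteq F$. A lax infinite tensor product is a lax cone $(\pi_F\colon X^K\to X^F)_F$ such that for every lax cone $(f_F\colon A\to X^F)_F$ there is a greatest morphism $g\colon A\to X^K$ with $\pi_F\circ g\le f_F$ for all finite $F$ (the induced morphism), and such that this lax limit is preserved by tensoring with an arbitrary object $Y$ (i.e. $(\mathrm{id}_Y\otimes\pi_F)_F$ has the same universal property with respect to the diagram $F\mapsto Y\otimes X^F$). It is a lax Kolmogorov product if all $\pi_F$ are deterministic. Infinite copies: in a quasi-Markov category with a strict Kolmogorov product $Y^K$ of the constant family $(Y)_{k\in K}$, for $f\colon X\to Y$ let $f^{(F)}\colon X\to Y^F$, for finite nonempty $F\subseteq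 K$, be the $|F|$-fold iterated copy of $X$ followed by $\bigotimes_{k\in F}f$, and $f^{(\emptyset)}:=\mathrm{del}_Y\circ f$. The $f^{(F)}$ form a cone, and the infinite copy $f^{(K)}\colon X\to Y^K$ is the unique morphism with $\pi_F\circ f^{(K)}=f^{(F)}$ for all finite $F$. For $u$ in $\mathsf{Partial}(\mathsf{C})$ the strict Kolmogorov product in $\mathsf{Partial}(\mathsf{C})$ used is the image of the one in $\mathsf{C}$. A Markov category $\mathsf{C}$ is partializable if: (i) it is positive; (ii) pullbacks of deterministic monomorphisms along arbitrary morphisms exist and are themselves deterministic (monomorphisms); (iii) if $i\colon D\to X$ is a deterministic monomorphism then $i\otimes\mathrm{id}_A$ is a monomorphism for every object $A$. For $\mathsf{C}$ partializable, the CD category $\mathsf{Partial}(\mathsf{C})$ (which is quasi-Markov) has the objects of $\mathsf{C}$; its morphisms $X\to Y$ are equivalence classes of spans $X\xleftarrow{i}D\xrightarrow{f}Y$ (also written $(D,i,f)$) in $\mathsf{C}$ with $i$ a deterministic monomorphism, where $(D,i,f)\sim(D',i',f')$ iff there is an isomorphism $t\colon D\to D'$ with $i'\circ t=i$, $f'\circ t=f$. The composite of $(A,i,f)\colon X\to Y$ followed by $(B,j,g)\colon Y\to Z$ is $(C,i\circ u,g\circ v)$, where $A\xleftarrow{u}C\xrightarrow{v}B$ is the pullback of $f$ and $j$. The inclusion $\mathsf{C}\hookrightarrow\mathsf{Partial}(\mathsf{C})$ sends $f\colon X\to Y$ to $(X,\mathrm{id}_X,f)$. The (finite) tensor product is componentwise,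 $(A,i,f)\otimes(B,j,g)=(A\otimes B,i\otimes j,f\otimes g)$, and the copy and delete maps (and coherence isomorphisms) are the images of those of $\mathsf{C}$ under the inclusion. The order $\le$ on hom-sets of $\mathsf{Partial}(\mathsf{C})$ is equivalently: $(B,j,g)\le(A,i,f)$ iff there is $t\colon B\to A$ in $\mathsf{C}$ with $i\circ t=j$ and $f\circ t=g$. *)

(* Defs.v *)
From mathcomp Require Import all_boot finmap boolp.

Set Implicit Arguments.
Unset Strict Implicit.
Unset Printing Implicit Defensive.

Declare Scope cat_scope.
Delimit Scope cat_scope with cat.
Local Open Scope fset_scope.
Local Open Scope cat_scope.

Reserved Notation "g ∘ f" (at level 40, left associativity).
Reserved Notation "X ⊗ Y" (at level 35, right associativity).
Reserved Notation "f ⊠ g" (at level 35, right associativity).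

Record category := Category {
  ob :> Type;
  hom : ob -> ob -> Type;
  idm : forall X, hom X X;
  comp : forall X Y Z, hom Y Z -> hom X Y -> hom X Z;
  comp1m : forall X Y (f : hom X Y), comp (idm Y) f = f;
  compm1 : forall X Y (f : hom X Y), comp f (idm X) = f;
  compA : forall W X Y Z (h : hom Y Z) (g : hom X Y) (f : hom W X),
    comp h (comp g f) = comp (comp h g) f
}.

Arguments hom {c}.
Arguments idm {c}.
Notation "g ∘ f" := (comp g f) : cat_scope.

Record sym_monoidal := SymMonoidal {
  smc_cat :> category;
  tens : smc_cat -> smc_cat -> smc_cat;
  one : smc_cat;
  tensm : forall X X' Y Y' : smc_cat,
    hom X Y -> hom X' Y' -> hom (tens X X') (tens Y Y');
  assoc : forall X Y Z : smc_cat, hom (tens (tens X Y) Z) (tens X (tens Y Z));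
  associ : forall X Y Z : smc_cat, hom (tens X (tens Y Z)) (tens (tens X Y) Z);
  lunit : forall X : smc_cat, hom (tens one X) X;
  luniti : forall X : smc_cat, hom X (tens one X);
  runit : forall X : smc_cat, hom (tens X one) X;
  runiti : forall X : smc_cat, hom X (tens X one);
  braid : forall X Y : smc_cat, hom (tens X Y) (tens Y X);
  tensm1 : forall X Y : smc_cat, tensm (idm X) (idm Y) = idm (tens X Y);
  tensm_comp : forall (X X' Y Y' Z Z' : smc_cat) (g : hom Y Z) (f : hom X Y)
      (g' : hom Y' Z') (f' : hom X' Y'),
    tensm (g ∘ f) (g' ∘ f') = tensm g g' ∘ tensm f f';
  assocK : forall X Y Z, associ X Y Z ∘ assoc X Y Z = idm _;
  associK : forall X Y Z, assoc X Y Z ∘ associ X Y Z = idm _;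
  lunitK : forall X, luniti X ∘ lunit X = idm _;
  lunitiK : forall X, lunit X ∘ luniti X = idm _;
  runitK : forall X, runiti X ∘ runit X = idm _;
  runitiK : forall X, runit X ∘ runiti X = idm _;
  braidK : forall X Y, braid Y X ∘ braid X Y = idm _;
  assoc_nat : forall (X X' Y Y' Z Z' : smc_cat)
      (f : hom X X') (g : hom Y Y') (h : hom Z Z'),
    assoc X' Y' Z' ∘ tensm (tensm f g) h = tensm f (tensm g h) ∘ assoc X Y Z;
  lunit_nat : forall (X Y : smc_cat) (f : hom X Y),
    lunit Y ∘ tensm (idm one) f = f ∘ lunit X;
  runit_nat : forall (X Y : smc_cat) (f : hom X Y),
    runit Y ∘ tensm f (idm one) = f ∘ runit X;
  braid_nat : forall (X X' Y Y' : smc_cat) (f : hom X X') (g : hom Y Y'),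
    braid X' Y' ∘ tensm f g = tensm g f ∘ braid X Y;
  pentagon : forall W X Y Z : smc_cat,
    assoc W X (tens Y Z) ∘ assoc (tens W X) Y Z =
    tensm (idm W) (assoc X Y Z) ∘ assoc W (tens X Y) Z ∘
      tensm (assoc W X Y) (idm Z);
  triangle : forall X Y : smc_cat,
    tensm (idm X) (lunit Y) ∘ assoc X one Y = tensm (runit X) (idm Y);
  hexagon : forall X Y Z : smc_cat,
    assoc Y Z X ∘ braid X (tens Y Z) ∘ assoc X Y Z =
    tensm (idm Y) (braid X Z) ∘ assoc Y X Z ∘ tensm (braid X Y) (idm Z);
  braid_unit : forall X : smc_cat, lunit X ∘ braid X one = runit X
}.

Arguments one {s}.
Notation "X ⊗ Y" := (tens X Y) : cat_scope.
Notation "f ⊠ g" := (tensm f g) : cat_scope.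

Definition mid_swap (C : sym_monoidal) (X Y Z W : C) :
    hom ((X ⊗ Y) ⊗ (Z ⊗ W)) ((X ⊗ Z) ⊗ (Y ⊗ W)) :=
  associ X Z (Y ⊗ W) ∘
  (idm X ⊠ (assoc Z Y W ∘ (braid Y Z ⊠ idm W) ∘ associ Y Z W)) ∘
  assoc X Y (Z ⊗ W).

Record cd_category := CDCategory {
  cd_smc :> sym_monoidal;
  copy : forall X : cd_smc, hom X (X ⊗ X);
  del : forall X : cd_smc, hom X one;
  copyA : forall X : cd_smc,
    assoc X X X ∘ (copy X ⊠ idm X) ∘ copy X = (idm X ⊠ copy X) ∘ copy X;
  copyC : forall X : cd_smc, braid X X ∘ copy X = copy X;
  copy_dell : forall X : cd_smc, lunit X ∘ (del X ⊠ idm X) ∘ copy X = idm X;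
  copy_delr : forall X : cd_smc, runit X ∘ (idm X ⊠ del X) ∘ copy X = idm X;
  copy_tens : forall X Y : cd_smc,
    copy (X ⊗ Y) = mid_swap X X Y Y ∘ (copy X ⊠ copy Y);
  del_tens : forall X Y : cd_smc, del (X ⊗ Y) = lunit one ∘ (del X ⊠ del Y);
  copy_one : copy one = luniti one;
  del_one : del one = idm one
}.

Section Morphisms.
Variable C : cd_category.

Definition total (X Y : C) (f : hom X Y) := del Y ∘ f = del X.

Definition copyable (X Y : C) (f : hom X Y) := copy Y ∘ f = (f ⊠ f) ∘ copy X.

Definition deterministic (X Y : C) (f : hom X Y) := total f /\ copyable f.

(* The right unitor appears because coherence isomorphisms are explicit. *)
Definition quasi_total (X Y : C) (f : hom X Y) :=
  runit Y ∘ (f ⊠ (del Y ∘ f)) ∘ copy X = f.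

(* [le_hom g f] is g <= f. *)
Definition le_hom (X Y : C) (g f : hom X Y) :=
  runit Y ∘ (f ⊠ (del Y ∘ g)) ∘ copy X = g.

Definition mono (X Y : C) (f : hom X Y) :=
  forall (Z : C) (g h : hom Z X), f ∘ g = f ∘ h -> g = h.

Definition is_iso (X Y : C) (f : hom X Y) :=
  exists g : hom Y X, g ∘ f = idm X /\ f ∘ g = idm Y.

Definition det_mono (X Y : C) (f : hom X Y) := deterministic f /\ mono f.

Definition is_pullback (X Y Z P : C) (f : hom X Z) (g : hom Y Z)
    (u : hom P X) (v : hom P Y) :=
  f ∘ u = g ∘ v /\
  forall (S : C) (p : hom S X) (q : hom S Y), f ∘ p = g ∘ q ->
    exists! h : hom S P, u ∘ h = p /\ v ∘ h = q.

End Morphisms.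

Definition markov (C : cd_category) :=
  forall (X Y : C) (f : hom X Y), total f.

Definition quasi_markov (C : cd_category) :=
  forall (X Y : C) (f : hom X Y), quasi_total f.

Definition positive (C : cd_category) :=
  forall (X Y Z : C) (u : hom X Y) (v : hom Y Z), deterministic (v ∘ u) ->
    (u ⊠ (v ∘ u)) ∘ copy X = (idm Y ⊠ v) ∘ copy Y ∘ u.

Record partializable (C : cd_category) : Prop := Partializable {
  partializable_markov : markov C;
  partializable_positive : positive C;
  partializable_pullback : forall (X Y Z : C) (f : hom X Z) (j : hom Y Z),
    det_mono j -> exists (P : C) (u : hom P X) (v : hom P Y),
      is_pullback f j u v /\ det_mono u;
  partializable_tens : forall (D X A : C) (i : hom D X),
    det_mono i -> mono (i ⊠ idm A)
}.

Section CDTheory.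
Variable C : cd_category.
Implicit Types X Y Z W A B D : C.

Lemma mono_id X : mono (idm X).
Proof. by move=> Z g h; rewrite !comp1m. Qed.

Lemma mono_comp X Y Z (g : hom Y Z) (f : hom X Y) :
  mono g -> mono f -> mono (g ∘ f).
Proof. by move=> mg mf W a b; rewrite -!compA => /mg /mf. Qed.

Lemma iso_mono X Y (f : hom X Y) : is_iso f -> mono f.
Proof.
move=> [g [gf _]] Z a b /(congr1 (fun k => g ∘ k)).
by rewrite !compA gf !comp1m.
Qed.

Lemma det_id X : deterministic (idm X).
Proof.
by split; rewrite /total /copyable ?compm1 // tensm1 comp1m.
Qed.

Lemma det_comp X Y Z (g : hom Y Z) (f : hom X Y) :
  deterministic g -> deterministic f -> deterministic (g ∘ f).
Proof.
move=> [tg cg] [tf cf]; split; first by rewrite /total compA tg.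
by rewrite /copyable compA cg -compA cf tensm_comp compA.
Qed.

Lemma det_mono_id X : det_mono (idm X).
Proof. by split; [exact: det_id|exact: mono_id]. Qed.

Lemma det_mono_comp X Y Z (g : hom Y Z) (f : hom X Y) :
  det_mono g -> det_mono f -> det_mono (g ∘ f).
Proof.
by move=> [dg mg] [df mf]; split; [exact: det_comp|exact: mono_comp].
Qed.

Lemma tens_split X X' Y Y' (f : hom X Y) (g : hom X' Y') :
  f ⊠ g = (f ⊠ idm Y') ∘ (idm X ⊠ g).
Proof. by rewrite -tensm_comp compm1 comp1m. Qed.

Lemma associ_nat X X' Y Y' Z Z' (f : hom X X') (g : hom Y Y') (h : hom Z Z') :
  associ X' Y' Z' ∘ (f ⊠ (g ⊠ h)) = ((f ⊠ g) ⊠ h) ∘ associ X Y Z.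
Proof.
rewrite -[LHS]compm1 -(associK X Y Z) -!compA (compA (f ⊠ _)) -assoc_nat.
by rewrite !compA assocK comp1m.
Qed.

Lemma mid_swap_nat X X' Y Y' Z Z' W W' (f : hom X X') (g : hom Y Y')
    (h : hom Z Z') (k : hom W W') :
  mid_swap X' Y' Z' W' ∘ ((f ⊠ g) ⊠ (h ⊠ k)) =
  ((f ⊠ h) ⊠ (g ⊠ k)) ∘ mid_swap X Y Z W.
Proof.
rewrite /mid_swap -!compA assoc_nat.
rewrite (compA (idm X' ⊠ _)) -tensm_comp comp1m.
rewrite -!compA associ_nat (compA (braid _ _ ⊠ _)) -tensm_comp braid_nat.
rewrite comp1m -{1}[k]compm1 tensm_comp -!compA (compA (assoc _ _ _)).
rewrite assoc_nat -compA -{1}[f]compm1 tensm_comp.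
by rewrite !compA associ_nat.
Qed.

Lemma det_tens X X' Y Y' (f : hom X Y) (g : hom X' Y') :
  deterministic f -> deterministic g -> deterministic (f ⊠ g).
Proof.
move=> [tf cf] [tg cg]; split.
  by rewrite /total !del_tens -compA -tensm_comp tf tg.
rewrite /copyable !copy_tens -compA -tensm_comp cf cg tensm_comp.
by rewrite compA mid_swap_nat compA.
Qed.

Lemma braid_one : braid one one = idm (one ⊗ one : C).
Proof.
have := copyC (one : C); rewrite copy_one => e.
by rewrite -[LHS]compm1 -lunitK compA e.
Qed.

Lemma mid_swap_one X Y : mid_swap X one one Y = idm _.
Proof.
rewrite /mid_swap braid_one tensm1 compm1 associK tensm1 compm1.
exact: assocK.
Qed.

Definition tproj1 X Y : hom (X ⊗ Y) X := runit X ∘ (idm X ⊠ del Y).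
Definition tproj2 X Y : hom (X ⊗ Y) Y := lunit Y ∘ (del X ⊠ idm Y).

Lemma pair_proj X Y : (tproj1 X Y ⊠ tproj2 X Y) ∘ copy (X ⊗ Y) = idm _.
Proof.
rewrite copy_tens tensm_comp compA -(compA (runit X ⊠ lunit Y)).
rewrite -mid_swap_nat mid_swap_one comp1m -!tensm_comp.
by rewrite copy_delr copy_dell tensm1.
Qed.

Lemma pair_eta X Y Z (m : hom Z (X ⊗ Y)) : copyable m ->
  ((tproj1 X Y ∘ m) ⊠ (tproj2 X Y ∘ m)) ∘ copy Z = m.
Proof.
by move=> cm; rewrite tensm_comp -compA -cm compA pair_proj comp1m.
Qed.

Hypothesis CM : markov C.

Lemma tproj1_nat X Y X' Y' (f : hom X X') (g : hom Y Y') :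
  tproj1 X' Y' ∘ (f ⊠ g) = f ∘ tproj1 X Y.
Proof.
by rewrite /tproj1 -compA -tensm_comp CM comp1m compA -runit_nat -compA
  -tensm_comp comp1m compm1.
Qed.

Lemma tproj2_nat X Y X' Y' (f : hom X X') (g : hom Y Y') :
  tproj2 X' Y' ∘ (f ⊠ g) = g ∘ tproj2 X Y.
Proof.
by rewrite /tproj2 -compA -tensm_comp CM comp1m compA -lunit_nat -compA
  -tensm_comp comp1m compm1.
Qed.

End CDTheory.

Section Spans.
Variable C : cd_category.
Implicit Types X Y Z W A B D : C.

Record span X Y := Span {
  span_dom : C;
  span_leg : hom span_dom X;
  span_map : hom span_dom Y;
  span_det_mono : det_mono span_leg
}.

Definition span_equiv X Y (s t : span X Y) :=
  exists h : hom (span_dom s) (span_dom t),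
    [/\ is_iso h, span_leg t ∘ h = span_leg s & span_map t ∘ h = span_map s].

(* Here [s] comes first: [r] is a composite of [s] followed by [t]. *)
Definition span_composite X Y Z (s : span X Y) (t : span Y Z) (r : span X Z) :=
  exists (u : hom (span_dom r) (span_dom s)) (v : hom (span_dom r) (span_dom t)),
    [/\ is_pullback (span_map s) (span_leg t) u v,
        span_leg r = span_leg s ∘ u & span_map r = span_map t ∘ v].

Lemma span_equivI X Y (s t : span X Y)
    (h : hom (span_dom s) (span_dom t)) (k : hom (span_dom t) (span_dom s)) :
  span_leg t ∘ h = span_leg s -> span_leg s ∘ k = span_leg t ->
  span_map t ∘ h = span_map s -> span_equiv s t.
Proof.
have [_ mi] := span_det_mono s; have [_ mj] := span_det_mono t.
move=> e1 e2 e3; exists h; split=> //; exists k; split.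
  by apply: mi; rewrite compA e2 e1 compm1.
by apply: mj; rewrite compA e1 e2 compm1.
Qed.

Lemma span_equiv_refl X Y (s : span X Y) : span_equiv s s.
Proof. by apply: (@span_equivI _ _ _ _ (idm _) (idm _)); rewrite compm1. Qed.

Lemma span_equiv_sym X Y (s t : span X Y) : span_equiv s t -> span_equiv t s.
Proof.
move=> [h [[k [kh hk]] e1 e2]]; exists k; split; first by exists h.
  by rewrite -e1 -compA hk compm1.
by rewrite -e2 -compA hk compm1.
Qed.

Lemma span_equiv_trans X Y (s t r : span X Y) :
  span_equiv s t -> span_equiv t r -> span_equiv s r.
Proof.
move=> [h [[h' [h1 h2]] e1 e2]] [k [[k' [k1 k2]] e3 e4]].
exists (k ∘ h); split; [|by rewrite compA e3 e1|by rewrite compA e4 e2].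
exists (h' ∘ k'); split.
  by rewrite -compA (compA k') k1 comp1m.
by rewrite -compA (compA h) h2 comp1m.
Qed.

(* An equivalence class of spans is encoded as its membership predicate.  By
   propositional extensionality, equal classes are Leibniz-equal, so [phom]
   can serve as a hom-type; composition is defined on members of the classes
   and does not depend on a choice of pullbacks. *)
Definition phom X Y :=
  {p : span X Y -> Prop | exists s, p = span_equiv s}.

Definition pclass X Y (s : span X Y) : phom X Y :=
  exist _ (span_equiv s) (ex_intro _ s erefl).

Lemma pclassP X Y (p : phom X Y) : exists s, p = pclass s.
Proof. by case: p => p [s e]; exists s; exact: eq_exist. Qed.

Lemma pclass_eq X Y (s t : span X Y) : span_equiv s t -> pclass s = pclass t.
Proof.
move=> st; apply: eq_exist; apply/predeqP => r; split => h.
  exact: span_equiv_trans (span_equiv_sym st) h.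
exact: span_equiv_trans st h.
Qed.

Lemma eq_pclass X Y (s t : span X Y) : pclass s = pclass t -> span_equiv s t.
Proof.
by move=> /(congr1 sval) /= ->; exact: span_equiv_refl.
Qed.

Lemma pclass_congr D X Y (i i' : hom D X) (f f' : hom D Y)
    (di : det_mono i) (di' : det_mono i') :
  i = i' -> f = f' -> pclass (Span f di) = pclass (Span f' di').
Proof.
by move=> ei ef; subst i' f'; congr (pclass (Span _ _)); exact: Prop_irrelevance.
Qed.

Definition incl X Y (f : hom X Y) : phom X Y :=
  pclass (Span f (det_mono_id X)).

Lemma pullback_iso X Y Z P (f : hom X Z) (j : hom Y Z) (u : hom P X)
    (v : hom P Y) : is_iso f -> is_iso v -> f ∘ u = j ∘ v ->
  is_pullback f j u v.
Proof.
move=> fi vi e; split=> // S p q pq; have [w [wv vw]] := vi.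
exists (w ∘ q); split.
  split; last by rewrite compA vw comp1m.
  apply: (iso_mono fi).
  by rewrite compA e -compA (compA v) vw comp1m.
by move=> h [_ <-]; rewrite compA wv comp1m.
Qed.

Lemma pullback_idr X Z (f : hom X Z) : is_pullback f (idm Z) (idm X) f.
Proof.
split; first by rewrite comp1m compm1.
move=> S p q; rewrite comp1m => e; exists p; split.
  by rewrite comp1m.
by move=> h [<- _]; rewrite comp1m.
Qed.

Section Comp.
Hypothesis HC : partializable C.

Lemma span_composite_ex X Y Z (s : span X Y) (t : span Y Z) :
  exists r, span_composite s t r.
Proof.
have [P [u [v [pb du]]]] :=
  partializable_pullback HC (span_map s) (span_det_mono t).
exists (Span (span_map t ∘ v) (det_mono_comp (span_det_mono s) du)).
by exists u, v.
Qed.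

Lemma span_composite_equiv X Y Z (s s' : span X Y) (t t' : span Y Z) r r' :
  span_equiv s s' -> span_equiv t t' ->
  span_composite s t r -> span_composite s' t' r' -> span_equiv r r'.
Proof.
have key (s1 s2 : span X Y) (t1 t2 : span Y Z) r1 r2 :
    span_equiv s1 s2 -> span_equiv t1 t2 ->
    span_composite s1 t1 r1 -> span_composite s2 t2 r2 ->
    exists h, span_leg r2 ∘ h = span_leg r1 /\ span_map r2 ∘ h = span_map r1.
  move=> [h [_ h1 h2]] [k [_ k1 k2]] [u [v [[e _] -> ->]]].
  move=> [u' [v' [[_ pb] -> ->]]].
  have [|w [[w1 w2] _]] := pb _ (h ∘ u) (k ∘ v).
    by rewrite !compA h2 k1.
  by exists w; rewrite -!compA w1 w2 !compA h1 k2.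
move=> es et c c'; have [h [h1 h2]] := key _ _ _ _ _ _ es et c c'.
have [k [k1 _]] :=
  key _ _ _ _ _ _ (span_equiv_sym es) (span_equiv_sym et) c' c.
exact: (@span_equivI _ _ _ _ h k).
Qed.

Lemma span_composite_closed X Y Z (s : span X Y) (t : span Y Z) r r' :
  span_composite s t r -> span_equiv r r' -> span_composite s t r'.
Proof.
move=> [u [v [[e pb] eu ev]]] [h [[k [kh hk]] h1 h2]].
exists (u ∘ k), (v ∘ k); split.
- split=> [|S p q pq]; first by rewrite !compA e.
  have [w [[w1 w2] wu]] := pb S p q pq; exists (h ∘ w); split.
    by rewrite -!compA !(compA k) kh comp1m.
  move=> w'; rewrite -!compA => /wu ->.
  by rewrite compA hk comp1m.
- by rewrite compA -eu -h1 -compA hk compm1.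
- by rewrite compA -ev -h2 -compA hk compm1.
Qed.

Lemma pcomp_subproof X Y Z (q : phom Y Z) (p : phom X Y) :
  exists r0, (fun r => exists s t,
    [/\ sval p s, sval q t & span_composite s t r]) = span_equiv r0.
Proof.
have [s ->] := pclassP p; have [t ->] := pclassP q.
have [r0 c0] := span_composite_ex s t; exists r0.
apply/predeqP => r /=; split=> [[s' [t' [es et c]]]|e].
  exact: span_composite_equiv es et c0 c.
exists s, t; split; [exact: span_equiv_refl..|].
exact: span_composite_closed c0 e.
Qed.

Definition pcomp X Y Z (q : phom Y Z) (p : phom X Y) : phom X Z :=
  exist _ _ (pcomp_subproof q p).

Lemma pcompE X Y Z (s : span X Y) (t : span Y Z) (r : span X Z) :
  span_composite s t r -> pcomp (pclass t) (pclass s) = pclass r.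
Proof.
move=> c0; apply: eq_exist; apply/predeqP => r' /=.
split=> [[s' [t' [es et c]]]|e].
  exact: span_composite_equiv es et c0 c.
exists s, t; split; [exact: span_equiv_refl..|].
exact: span_composite_closed c0 e.
Qed.

Lemma pcomp1m X Y (p : phom X Y) : pcomp (incl (idm Y)) p = p.
Proof.
have [s ->] := pclassP p; apply: pcompE.
exists (idm _), (span_map s); split; first exact: pullback_idr.
  by rewrite compm1.
by rewrite comp1m.
Qed.

Lemma pcomp_incl X Y Z (s : span X Y) (g : hom Y Z) :
  pcomp (incl g) (pclass s) =
  pclass (Span (g ∘ span_map s) (span_det_mono s)).
Proof.
apply: pcompE; exists (idm _), (span_map s); split=> /=.
- exact: pullback_idr.
- by rewrite compm1.
- by [].
Qed.

Lemma incl_comp X Y Z (g : hom Y Z) (f : hom X Y) :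
  incl (g ∘ f) = pcomp (incl g) (incl f).
Proof. by rewrite pcomp_incl. Qed.

Lemma id_iso X : is_iso (idm X).
Proof. by exists (idm X); rewrite comp1m. Qed.

Lemma pcomp_square X X' Y Y' (a : hom X X') (b : hom Y Y')
    (s : span X Y) (t : span X' Y') (h : hom (span_dom s) (span_dom t)) :
  is_iso a -> is_iso h ->
  a ∘ span_leg s = span_leg t ∘ h -> b ∘ span_map s = span_map t ∘ h ->
  pcomp (incl b) (pclass s) = pcomp (pclass t) (incl a).
Proof.
move=> ai hi e1 e2; rewrite pcomp_incl; apply/esym/pcompE.
exists (span_leg s), h; split=> //=; first exact: pullback_iso.
by rewrite comp1m.
Qed.

Lemma pcompm1 X Y (p : phom X Y) : pcomp p (incl (idm X)) = p.
Proof.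
have [s ->] := pclassP p.
rewrite -[RHS]pcomp1m; apply/esym/(@pcomp_square _ _ _ _ _ _ _ _ (idm _)).
- exact: id_iso.
- exact: id_iso.
- by rewrite comp1m compm1.
- by rewrite comp1m compm1.
Qed.

Lemma pullback_inj X Y Z P (f : hom X Z) (j : hom Y Z) (u : hom P X)
    (v : hom P Y) S (h k : hom S P) : is_pullback f j u v ->
  u ∘ h = u ∘ k -> v ∘ h = v ∘ k -> h = k.
Proof.
move=> [e pb] uh vh.
have [|w [_ wu]] := pb S (u ∘ h) (v ∘ h); first by rewrite !compA e.
by rewrite -(wu h) // -(wu k).
Qed.

Lemma pcompA W X Y Z (r : phom Y Z) (q : phom X Y) (p : phom W X) :
  pcomp r (pcomp q p) = pcomp (pcomp r q) p.
Proof.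
have [s ->] := pclassP p; have [t ->] := pclassP q; have [k ->] := pclassP r.
have [st cst] := span_composite_ex s t; have [tk ctk] := span_composite_ex t k.
have [x cx] := span_composite_ex st k.
rewrite (pcompE cst) (pcompE ctk) (pcompE cx); apply/esym/pcompE.
case: cst => u [v [pb1 el1 em1]]; case: ctk => a [b [pb2 el2 em2]].
case: cx => u' [v' [pb3 el3 em3]].
rewrite em1 in pb3.
have [|w [[w1 w2] _]] := pb2.2 _ (v ∘ u') v'; first by rewrite compA pb3.1.
exists (u ∘ u'), w; split.
- rewrite el2; split=> [|S l m lm].
    by rewrite compA pb1.1 -!compA w1.
  have [|m1 [[m11 m12] _]] := pb1.2 S l (a ∘ m); first by rewrite lm compA.
  have [|m2 [[m21 m22] _]] := pb3.2 S m1 (b ∘ m).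
    by rewrite -compA m12 !compA pb2.1.
  exists m2; split; first split.
  + by rewrite -compA m21.
  + apply: (pullback_inj pb2); first by rewrite compA w1 -compA m21 m12.
    by rewrite compA w2 m22.
  move=> m' [e1 e2]; apply: (pullback_inj pb3).
    apply: (pullback_inj pb1); first by rewrite m21 m11 compA e1.
    by rewrite m21 m12 compA -w1 -compA e2.
  by rewrite m22 -w2 -compA e2.
- by rewrite el3 el1 compA.
- by rewrite em3 em2 -compA w2.
Qed.

Definition partial_cat : category := Category pcomp1m pcompm1 pcompA.

Lemma det_mono_tens X X' Y Y' (f : hom X Y) (g : hom X' Y') :
  det_mono f -> det_mono g -> det_mono (f ⊠ g).
Proof.
move=> [df mf] [dg mg]; split; first exact: det_tens.
rewrite tens_split; apply: mono_comp.
  by apply: (partializable_tens HC); split.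
have -> : idm X ⊠ g = braid Y' X ∘ (g ⊠ idm X) ∘ braid X X'.
  by rewrite braid_nat -compA braidK compm1.
apply: mono_comp; last by apply: iso_mono; exists (braid X' X); rewrite !braidK.
apply: mono_comp; last by apply: (partializable_tens HC); split.
by apply: iso_mono; exists (braid X Y'); rewrite !braidK.
Qed.

Definition span_tens X X' Y Y' (s : span X Y) (t : span X' Y') :
    span (X ⊗ X') (Y ⊗ Y') :=
  Span (span_map s ⊠ span_map t)
    (det_mono_tens (span_det_mono s) (span_det_mono t)).

Lemma span_tens_equiv X X' Y Y' (s s' : span X Y) (t t' : span X' Y') :
  span_equiv s s' -> span_equiv t t' ->
  span_equiv (span_tens s t) (span_tens s' t').
Proof.
move=> [h [[h' [h1 h2]] e1 e2]] [k [[k' [k1 k2]] e3 e4]].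
exists (h ⊠ k); split; first exists (h' ⊠ k').
- by rewrite -!tensm_comp h1 h2 k1 k2 !tensm1.
- by rewrite /= -tensm_comp e1 e3.
- by rewrite /= -tensm_comp e2 e4.
Qed.

Lemma ptens_subproof X X' Y Y' (p : phom X Y) (q : phom X' Y') :
  exists r0, (fun r => exists s t,
    [/\ sval p s, sval q t & span_equiv (span_tens s t) r]) = span_equiv r0.
Proof.
have [s ->] := pclassP p; have [t ->] := pclassP q.
exists (span_tens s t); apply/predeqP => r /=; split=> [[s' [t' [es et c]]]|e].
  exact: span_equiv_trans (span_tens_equiv es et) c.
by exists s, t; split=> //; exact: span_equiv_refl.
Qed.

Definition ptens X X' Y Y' (p : phom X Y) (q : phom X' Y') :
    phom (X ⊗ X') (Y ⊗ Y') :=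
  exist _ _ (ptens_subproof p q).

Lemma ptensE X X' Y Y' (s : span X Y) (t : span X' Y') :
  ptens (pclass s) (pclass t) = pclass (span_tens s t).
Proof.
apply: eq_exist; apply/predeqP => r /=; split=> [[s' [t' [es et c]]]|e].
  exact: span_equiv_trans (span_tens_equiv es et) c.
by exists s, t; split=> //; exact: span_equiv_refl.
Qed.

Lemma incl_tens X X' Y Y' (f : hom X Y) (g : hom X' Y') :
  ptens (incl f) (incl g) = incl (f ⊠ g).
Proof.
by rewrite ptensE; apply: pclass_congr => //=; rewrite tensm1.
Qed.

Lemma pullback_tens X Y Z P X' Y' Z' P' (f : hom X Z) (j : hom Y Z)
    (u : hom P X) (v : hom P Y) (f' : hom X' Z') (j' : hom Y' Z')
    (u' : hom P' X') (v' : hom P' Y') :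
  det_mono j -> det_mono j' -> mono (u ⊠ u') ->
  is_pullback f j u v -> is_pullback f' j' u' v' ->
  is_pullback (f ⊠ f') (j ⊠ j') (u ⊠ u') (v ⊠ v').
Proof.
move=> dj dj' mu [e pb] [e' pb']; split.
  by rewrite -!tensm_comp e e'.
move=> S p q pq; have CM := partializable_markov HC.
have [R [m [n [[mn pbR] [[_ cm] mm]]]]] :=
  partializable_pullback HC (f ⊠ f') (det_mono_tens dj dj').
have [|c1 [[c11 _] _]] := pb R (tproj1 _ _ ∘ m) (tproj1 _ _ ∘ n).
  by rewrite (compA f) (compA j) -(tproj1_nat CM _ f') -(tproj1_nat CM _ j') -(compA _ _ m) mn compA.
have [|c2 [[c21 _] _]] := pb' R (tproj2 _ _ ∘ m) (tproj2 _ _ ∘ n).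
  by rewrite (compA f') (compA j') -(tproj2_nat CM f) -(tproj2_nat CM j) -(compA _ _ m) mn compA.
pose h := (c1 ⊠ c2) ∘ copy R.
have uh : (u ⊠ u') ∘ h = m.
  by rewrite /h compA -tensm_comp c11 c21 pair_eta.
have vh : (v ⊠ v') ∘ h = n.
  apply: (det_mono_tens dj dj').2.
  by rewrite compA -tensm_comp -e -e' tensm_comp -(compA (f ⊠ f')) uh.
clearbody h; have [w [[w1 w2] _]] := pbR S p q pq.
exists (h ∘ w); split; first by rewrite !compA uh vh.
by move=> k [k1 _]; apply: mu; rewrite compA uh w1 k1.
Qed.

Lemma ptens_comp X X' Y Y' Z Z' (q : phom Y Z) (p : phom X Y)
    (q' : phom Y' Z') (p' : phom X' Y') :
  ptens (pcomp q p) (pcomp q' p') = pcomp (ptens q q') (ptens p p').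
Proof.
have [s ->] := pclassP p; have [t ->] := pclassP q.
have [s' ->] := pclassP p'; have [t' ->] := pclassP q'.
have [r c] := span_composite_ex s t; have [r' c'] := span_composite_ex s' t'.
rewrite (pcompE c) (pcompE c') !ptensE; apply/esym/pcompE.
case: c => u [v [pb el em]]; case: c' => u' [v' [pb' el' em']].
exists (u ⊠ u'), (v ⊠ v'); split; last 2 first.
- by rewrite /= -tensm_comp el el'.
- by rewrite /= -tensm_comp em em'.
apply: pullback_tens => //; try exact: span_det_mono.
move=> S g h gh; apply: (span_det_mono (span_tens r r')).2.
by rewrite /= el el' tensm_comp -!compA gh.
Qed.

Lemma ptens1 X Y : ptens (incl (idm X)) (incl (idm Y)) = incl (idm (X ⊗ Y)).
Proof. by rewrite incl_tens tensm1. Qed.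

Lemma incl_inv X Y (f : hom X Y) (g : hom Y X) :
  g ∘ f = idm X -> pcomp (incl g) (incl f) = incl (idm X).
Proof. by rewrite -incl_comp => ->. Qed.

Lemma passoc_nat X X' Y Y' Z Z' (p : phom X X') (q : phom Y Y')
    (r : phom Z Z') :
  pcomp (incl (assoc X' Y' Z')) (ptens (ptens p q) r) =
  pcomp (ptens p (ptens q r)) (incl (assoc X Y Z)).
Proof.
have [s ->] := pclassP p; have [t ->] := pclassP q; have [k ->] := pclassP r.
have ai A B D : is_iso (assoc A B D).
  by exists (associ A B D); rewrite assocK associK.
rewrite !ptensE; apply: pcomp_square; [exact: ai|exact: ai|..];
  exact: assoc_nat.
Qed.

Lemma plunit_nat X Y (p : phom X Y) :
  pcomp (incl (lunit Y)) (ptens (incl (idm one)) p) =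
  pcomp p (incl (lunit X)).
Proof.
have [s ->] := pclassP p.
have ai A : is_iso (lunit A) by exists (luniti A); rewrite lunitK lunitiK.
rewrite !ptensE; apply: pcomp_square; [exact: ai|exact: ai|..];
  exact: lunit_nat.
Qed.

Lemma prunit_nat X Y (p : phom X Y) :
  pcomp (incl (runit Y)) (ptens p (incl (idm one))) =
  pcomp p (incl (runit X)).
Proof.
have [s ->] := pclassP p.
have ai A : is_iso (runit A) by exists (runiti A); rewrite runitK runitiK.
rewrite !ptensE; apply: pcomp_square; [exact: ai|exact: ai|..];
  exact: runit_nat.
Qed.

Lemma pbraid_nat X X' Y Y' (p : phom X X') (q : phom Y Y') :
  pcomp (incl (braid X' Y')) (ptens p q) =
  pcomp (ptens q p) (incl (braid X Y)).
Proof.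
have [s ->] := pclassP p; have [t ->] := pclassP q.
have ai A B : is_iso (braid A B) by exists (braid B A); rewrite !braidK.
rewrite !ptensE; apply: pcomp_square; [exact: ai|exact: ai|..];
  exact: braid_nat.
Qed.

Definition partial_smc : sym_monoidal.
Proof.
refine (@SymMonoidal partial_cat (@tens C) one ptens
  (fun X Y Z => incl (assoc X Y Z)) (fun X Y Z => incl (associ X Y Z))
  (fun X => incl (lunit X)) (fun X => incl (luniti X))
  (fun X => incl (runit X)) (fun X => incl (runiti X))
  (fun X Y => incl (braid X Y)) ptens1 ptens_comp
  (fun X Y Z => incl_inv (assocK X Y Z))
  (fun X Y Z => incl_inv (associK X Y Z))
  (fun X => incl_inv (lunitK X)) (fun X => incl_inv (lunitiK X))
  (fun X => incl_inv (runitK X)) (fun X => incl_inv (runitiK X))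
  (fun X Y => incl_inv (braidK X Y))
  passoc_nat plunit_nat prunit_nat pbraid_nat _ _ _ _).
- by move=> W X Y Z /=; rewrite !incl_tens -!incl_comp pentagon.
- by move=> X Y /=; rewrite !incl_tens -!incl_comp triangle.
- by move=> X Y Z /=; rewrite !incl_tens -!incl_comp hexagon.
- by move=> X /=; rewrite -!incl_comp braid_unit.
Defined.

Definition partial : cd_category.
Proof.
refine (@CDCategory partial_smc
  (fun X => incl (copy X)) (fun X => incl (del X)) _ _ _ _ _ _ _ _).
- by move=> X /=; rewrite !incl_tens -!incl_comp copyA.
- by move=> X /=; rewrite -!incl_comp copyC.
- by move=> X /=; rewrite !incl_tens -!incl_comp copy_dell.
- by move=> X /=; rewrite !incl_tens -!incl_comp copy_delr.
- move=> X Y /=; rewrite /mid_swap /=.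
  by rewrite !(incl_tens, =^~ incl_comp) copy_tens.
- by move=> X Y /=; rewrite !incl_tens -!incl_comp del_tens.
- by rewrite /= copy_one.
- by rewrite /= del_one.
Defined.

Lemma pquasi_total X Y (p : phom X Y) :
  pcomp (pcomp (incl (runit Y)) (ptens p (pcomp (incl (del Y)) p)))
    (incl (copy X)) = p.
Proof.
have [s ->] := pclassP p; have CM := partializable_markov HC.
rewrite pcomp_incl ptensE pcomp_incl /= CM.
case: s => D i f di /=; have [[_ ci] mi] := di.
have quasi_f : runit Y ∘ (f ⊠ del D) ∘ copy D = f.
  rewrite -[f in f ⊠ _]compm1 -(comp1m (del D)) tensm_comp compA runit_nat.
  by rewrite -!compA (compA (runit D)) copy_delr compm1.
rewrite -(pclass_congr di di erefl quasi_f).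
apply: pcompE; exists i, (copy D); split=> /=; last 2 first.
- by rewrite comp1m.
- by [].
split=> [|T a b ab]; first exact: ci.
have ia : i ∘ (tproj1 D D ∘ b) = a.
  rewrite compA -(tproj1_nat CM i i) -compA -ab compA /tproj1.
  by rewrite copy_delr comp1m.
exists (tproj1 D D ∘ b); split; first split=> //.
  apply: (det_mono_tens di di).2.
  by rewrite compA -ci -compA ia.
by move=> h [ih _]; apply: mi; rewrite ia ih.
Qed.

Lemma partial_quasi_markov : quasi_markov partial.
Proof. exact: pquasi_total. Qed.

End Comp.

End Spans.

(* Coherence isomorphisms are explicit here, so a tensor product over a finite
   set needs an ordering of its factors.  For a duplicate-free sequence [s],
   [tens_seq X s] is the tensor product of the [X k], [k \in s], bracketed to
   the right and ending with the unit. *)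

Section FiniteTensor.
Variables (C : cd_category) (K : choiceType).
Implicit Types (X Y : K -> C) (k : K) (s t : seq K) (F G : {fset K}).

Fixpoint tens_seq X s : C :=
  if s is k :: s' then X k ⊗ tens_seq X s' else one.

Fixpoint tensm_seq X Y (f : forall k, hom (X k) (Y k)) s :
    hom (tens_seq X s) (tens_seq Y s) :=
  if s is k :: s' then f k ⊠ tensm_seq f s' else idm one.

Definition swap_front (A B D : C) : hom (A ⊗ (B ⊗ D)) (B ⊗ (A ⊗ D)) :=
  assoc B A D ∘ (braid A B ⊠ idm D) ∘ associ A B D.

Definition hom_eq X k l (e : k = l) : hom (X k) (X l) :=
  let: erefl := e in idm (X k).

Lemma mem_behead k l s : l \in k :: s -> (k == l) = false -> l \in s.
Proof. by rewrite inE eq_sym => /orP[-> |]. Qed.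

(* The symmetry moving the (first) factor [k] of [s] to the front. *)
Fixpoint to_front X k s :
    k \in s -> hom (tens_seq X s) (X k ⊗ tens_seq X (rem k s)) :=
  match s with
  | [::] => fun ks => False_rect _ (notF ks)
  | l :: s' => fun ks =>
      (if l == k as b return (l == k) = b -> hom (X l ⊗ tens_seq X s')
          (X k ⊗ tens_seq X (if b then s' else l :: rem k s'))
       then fun e => hom_eq X (eqP e) ⊠ idm (tens_seq X s')
       else fun e => swap_front (X l) (X k) (tens_seq X (rem k s')) ∘
         (idm (X l) ⊠ to_front X (mem_behead ks e))) erefl
  end.

Definition uniq_sub t s := uniq t && all (mem s) t.

Lemma uniq_sub_head k t s : uniq_sub (k :: t) s -> k \in s.
Proof. by case/and3P. Qed.

Lemma uniq_sub_behead k t s : uniq_sub (k :: t) s -> uniq_sub t (rem k s).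
Proof.
case/and3P=> /andP[kt ut] ks /allP ts; apply/andP; split=> //; apply/allP=> l lt.
apply: rem_mem; last exact: ts.
by apply: contraNneq kt => <-.
Qed.

Lemma uniq_sub_fset F G : G `<=` F -> uniq_sub G F.
Proof.
by move=> /fsubsetP GF; rewrite /uniq_sub fset_uniq; apply/allP => k /GF.
Qed.

(* Permute the factors of [t] to the front, in the order of [t], and delete the
   remaining ones. *)
Fixpoint marginal X t s :
    uniq_sub t s -> hom (tens_seq X s) (tens_seq X t) :=
  match t with
  | [::] => fun _ => del (tens_seq X s)
  | k :: t' => fun ts =>
      (idm (X k) ⊠ marginal X (uniq_sub_behead ts)) ∘
      to_front X (uniq_sub_head ts)
  end.

(* The iterated copy; it is the deletion when [s] is empty. *)
Fixpoint copy_seq (A : C) s : hom A (tens_seq (fun _ => A) s) :=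
  if s is k :: s' then (idm A ⊠ copy_seq A s') ∘ copy A else del A.

(* The morphism f^(s).  In the empty case it is [del B ∘ f], which differs from
   [del A] if [f] is not total. *)
Definition multicopy (A B : C) (f : hom A B) s :
    hom A (tens_seq (fun _ => B) s) :=
  match s with
  | [::] => del B ∘ f
  | k :: s' => tensm_seq (fun _ => f) (k :: s') ∘ copy_seq A (k :: s')
  end.

End FiniteTensor.

Notation "g ⊑ f" := (le_hom g f) (at level 70) : cat_scope.

Section Kolmogorov.
Variables (C : cd_category) (K : choiceType).
Implicit Types (X Y : K -> C) (F G : {fset K}) (A L : C).

(* The data of a diagram of shape FinSub(K)^op; [fs_map] is not required to be
   functorial, as (lax) cones and their universal properties do not refer to
   functoriality. *)
Record fs_diagram := FsDiagram {
  fs_ob : {fset K} -> C;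
  fs_map : forall F G, G `<=` F -> hom (fs_ob F) (fs_ob G)
}.

Definition tens_diagram X : fs_diagram :=
  FsDiagram (fun F G (GF : G `<=` F) => marginal X (uniq_sub_fset GF)).

Definition diagram_tens (A : C) (D : fs_diagram) : fs_diagram :=
  FsDiagram (fun F G (GF : G `<=` F) => idm A ⊠ fs_map D GF).

Definition fs_family (D : fs_diagram) A := forall F, hom A (fs_ob D F).

Definition family_tens A (D : fs_diagram) L (p : fs_family D L) :
  fs_family (diagram_tens A D) (A ⊗ L) := fun F => idm A ⊠ p F.

Definition is_cone D A (f : fs_family D A) :=
  forall F G (GF : G `<=` F), fs_map D GF ∘ f F = f G.

Definition is_limit D L (p : fs_family D L) :=
  is_cone p /\
  forall A (f : fs_family D A), is_cone f ->
    exists! g : hom A L, forall F, p F ∘ g = f F.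

Definition is_lax_cone D A (f : fs_family D A) :=
  forall F G (GF : G `<=` F), fs_map D GF ∘ f F ⊑ f G.

Definition lax_induced D L (p : fs_family D L) A (f : fs_family D A)
    (g : hom A L) :=
  (forall F, p F ∘ g ⊑ f F) /\
  forall g' : hom A L, (forall F, p F ∘ g' ⊑ f F) -> g' ⊑ g.

Definition is_lax_limit D L (p : fs_family D L) :=
  is_lax_cone p /\
  forall A (f : fs_family D A), is_lax_cone f ->
    exists g : hom A L, lax_induced p f g.

Definition kolmogorov_product X L (p : fs_family (tens_diagram X) L) :=
  [/\ is_limit p,
      forall A, is_limit (family_tens A p) &
      forall F, deterministic (p F)].

Definition lax_infinite_tensor X L (p : fs_family (tens_diagram X) L) :=
  is_lax_limit p /\ forall A, is_lax_limit (family_tens A p).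

Definition lax_kolmogorov_product X L (p : fs_family (tens_diagram X) L) :=
  lax_infinite_tensor p /\ forall F, deterministic (p F).

Definition infinite_tensor X Y LX (pX : fs_family (tens_diagram X) LX)
    LY (pY : fs_family (tens_diagram Y) LY) (f : forall k, hom (X k) (Y k))
    (g : hom LX LY) :=
  unique (fun h => forall F, pY F ∘ h = tensm_seq f F ∘ pX F) g.

Definition infinite_copy (A B : C) L
    (p : fs_family (tens_diagram (fun _ : K => B)) L) (f : hom A B)
    (g : hom A L) :=
  unique (fun h => forall F, p F ∘ h = multicopy f F) g.

End Kolmogorov.

Definition has_kolmogorov_products (C : cd_category) (K : choiceType) :=
  forall X : K -> C, exists L (p : fs_family (tens_diagram X) L),
    kolmogorov_product p.

Definition incl_family (C : cd_category) (HC : partializable C)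
    (K : choiceType) (X : K -> C) (L : C) (p : fs_family (tens_diagram X) L) :
    fs_family (C := partial HC) (tens_diagram (C := partial HC) X) L :=
  fun F => incl (p F).

(* Main.v *)
From mathcomp Require Import all_boot finmap.
From mathcomp Require Import boolp.
Require Import Defs.

Set Implicit Arguments.
Unset Strict Implicit.
Unset Printing Implicit Defensive.

Local Open Scope fset_scope.
Local Open Scope cat_scope.

(** In the category of partial morphisms, [g <= f] means that the span [g]
    factors through the span [f] ([le_span]).  Testing [g <= r ∘ s] against the
    pullback that defines the composite then only requires two maps, one into
    the domain of [s] and one into the domain of [r] ([le_span_comp]).  With
    these two criteria every claim about [Partial C] becomes a claim about [C].

    For the first part, a lax cone consists of spans [A <- D F -> X^F] whose
    domains decrease as [F] grows, compatibly with the marginalizations.  Let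
    [E] be the intersection of all the [D F] as deterministic subobjects of
    [A].  On [E] the maps to the [X^F] form a strict cone, hence induce
    [E -> X^K] in [C], and the resulting partial morphism is the greatest one:
    a competitor has its domain below every [D F], so below [E], and joint
    monicity of the projections identifies its map.  Nothing here is special to
    the diagram [X^F]: every limit in [C] becomes a lax limit in [Partial C]
    ([limit_lax_limit]), so preservation under tensoring comes for free.

    What remains is the existence of [E].  A [K]-indexed intersection of
    deterministic monomorphisms [i k : D k -> A] is the pullback of their
    infinite tensor product [⨂ i k] along the infinite copy [A -> A^K]
    ([has_meets_kolmogorov]); the infinite tensor product is again a
    deterministic monomorphism because the projections are jointly monic, also
    after tensoring.  The intersection over all finite subsets is obtained from
    [K]-indexed ones as follows ([lax_cone_meet]).  If [K] is finite, the term
    at [F = K] is the smallest.  If [K] is infinite, then [K] has the natural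
    numbers as a retract, so countable intersections exist; iterating
    [K]-indexed intersections gives those indexed by [K^n], and a countable
    intersection of these covers all finite subsets of [K].

    For the second part, a partial morphism below all the [u^F ∘ π_F] amounts to
    a family of maps from its domain to the [⨂_(k in F) D k]; it is a cone
    because the legs are monic, so it factors through [⨂_k D k]
    ([lax_induced_tensor]).

    For the third part, the pullback of [i ⊗ ... ⊗ i] along an iterated copy is
    [D] itself as soon as there is at least one factor, and for no factor the
    domain of [del ∘ u] is [D] as well ([partial_multicopy]).  In particular all
    components of the infinite copy have domain [D], which yields existence and
    uniqueness ([infinite_copy_span]). *)

Lemma dependent_choice T (U : T -> Type) (P : forall x, U x -> Prop) :
  (forall x, exists y, P x y) -> exists f : forall x, U x, forall x, P x (f x).
Proof.
move=> h; exists (fun x => projT1 (cid (h x))) => x.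
exact: projT2 (cid (h x)).
Qed.

(** * Marginalization and iterated copying *)

Section Projections.
Variable C : cd_category.
Implicit Types A B Y : C.

Lemma tproj1_copy A : tproj1 A A ∘ copy A = idm A.
Proof. exact: copy_delr. Qed.

Lemma tproj2_copy A : tproj2 A A ∘ copy A = idm A.
Proof. exact: copy_dell. Qed.

Lemma runit_del A B Y (f : hom A Y) :
  runit Y ∘ (f ⊠ del B) = f ∘ tproj1 A B.
Proof.
rewrite -[f in LHS]compm1 -(comp1m (del B)) tensm_comp compA runit_nat.
by rewrite -compA.
Qed.

End Projections.

Section FiniteTensorMaps.
Variables (C : cd_category) (K : choiceType).
Implicit Types (X Y Z : K -> C) (k : K) (s t : seq K) (A B : C).

Lemma swap_front_nat A A' B B' D D' (f : hom A A') (g : hom B B')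
    (h : hom D D') :
  swap_front A' B' D' ∘ (f ⊠ (g ⊠ h)) =
  (g ⊠ (f ⊠ h)) ∘ swap_front A B D.
Proof.
rewrite /swap_front -!compA associ_nat (compA (braid _ _ ⊠ _)) -tensm_comp.
rewrite braid_nat comp1m -{1}[h]compm1 tensm_comp -!compA.
by rewrite (compA (assoc _ _ _)) assoc_nat -!compA.
Qed.

Lemma hom_eq_nat X Y (f : forall k, hom (X k) (Y k)) k l (e : k = l) :
  hom_eq Y e ∘ f k = f l ∘ hom_eq X e.
Proof. by case: l / e; rewrite comp1m compm1. Qed.

Lemma to_front_nat X Y (f : forall k, hom (X k) (Y k)) k s (ks : k \in s) :
  to_front Y ks ∘ tensm_seq f s =
  (f k ⊠ tensm_seq f (rem k s)) ∘ to_front X ks.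
Proof.
(* The type of [to_front] depends on the value of [l == k]: the two proof
   terms that mention this test are generalized before the case analysis. *)
elim: s ks => [|l s IH] ks //=.
move: (mem_behead ks) (@eqP _ l k).
move: (l == k) => [] mb lk /=.
  rewrite -!tensm_comp comp1m compm1; congr (_ ⊠ _).
  exact: hom_eq_nat.
by rewrite compA -swap_front_nat -!compA -!tensm_comp IH comp1m compm1.
Qed.
(** The three outputs of a twofold copy are interchangeable: reassociating by
    [copyA] exposes the two factors that [braid] exchanges, and [copyC] absorbs
    the exchange. *)
Lemma swap_front_copy A :
  swap_front A A A ∘ ((idm A ⊠ copy A) ∘ copy A) = (idm A ⊠ copy A) ∘ copy A.
Proof.
rewrite -copyA /swap_front -!compA (compA (associ _ _ _)) assocK comp1m.
by rewrite (compA (braid A A ⊠ _)) -tensm_comp copyC comp1m.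
Qed.

Lemma hom_eq_const A k l (e : k = l) : hom_eq (fun=> A) e = idm A.
Proof. by case: l / e. Qed.

(** This is what makes [marginal_copy] work: an iterated copy is invariant under
    moving one of its outputs to the front. *)
Lemma to_front_copy A k s (ks : k \in s) :
  to_front (fun=> A) ks ∘ copy_seq A s =
  (idm A ⊠ copy_seq A (rem k s)) ∘ copy A.
Proof.
elim: s ks => [|l s IH] ks //=.
move: (mem_behead ks) (@eqP _ l k).
move: (l == k) => [] mb lk /=.
  by rewrite compA -tensm_comp hom_eq_const !comp1m.
rewrite compA -(compA (swap_front _ _ _)) -tensm_comp IH comp1m.
rewrite -[X in X ⊠ (_ ∘ copy A)](comp1m (idm A)) !tensm_comp.
rewrite compA swap_front_nat -(compA _ (swap_front A A A)) -[LHS]compA.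
by rewrite -(compA (swap_front A A A)) swap_front_copy compA.
Qed.

Definition seq_proj X k s (ks : k \in s) : hom (tens_seq X s) (X k) :=
  tproj1 _ _ ∘ to_front X ks.

Hypothesis CM : markov C.

Lemma seq_proj_nat X Y (f : forall k, hom (X k) (Y k)) k s (ks : k \in s) :
  seq_proj Y ks ∘ tensm_seq f s = f k ∘ seq_proj X ks.
Proof. by rewrite /seq_proj -compA to_front_nat compA (tproj1_nat CM) -compA. Qed.

Lemma seq_proj_copy A k s (ks : k \in s) :
  seq_proj (fun=> A) ks ∘ copy_seq A s = idm A.
Proof.
rewrite /seq_proj -compA to_front_copy compA (tproj1_nat CM) comp1m.
exact: tproj1_copy.
Qed.

Lemma marginal_nat X Y (f : forall k, hom (X k) (Y k)) t s
    (ts : uniq_sub t s) :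
  marginal Y ts ∘ tensm_seq f s = tensm_seq f t ∘ marginal X ts.
Proof.
elim: t s ts => [|k t IH] s ts /=; first by rewrite CM comp1m.
by rewrite -compA to_front_nat !compA -!tensm_comp IH comp1m compm1.
Qed.

Lemma marginal_copy A t s (ts : uniq_sub t s) :
  marginal (fun=> A) ts ∘ copy_seq A s = copy_seq A t.
Proof.
elim: t s ts => [|k t IH] s ts /=; first by rewrite CM.
by rewrite -compA to_front_copy compA -tensm_comp IH comp1m.
Qed.


Lemma copy_seq_nat A B (m : hom A B) s : deterministic m ->
  copy_seq B s ∘ m = tensm_seq (fun=> m) s ∘ copy_seq A s.
Proof.
move=> [_ cm]; elim: s => [|k s IH] /=; first by rewrite comp1m CM.
by rewrite -compA cm !compA -!tensm_comp IH comp1m compm1.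
Qed.

Lemma eq_tensm_seq X Y (f g : forall k, hom (X k) (Y k)) s :
  (forall k, f k = g k) -> tensm_seq f s = tensm_seq g s.
Proof. by move=> fg; elim: s => [|k s IH] //=; rewrite fg IH. Qed.

Lemma tensm_seq_comp X Y Z (g : forall k, hom (Y k) (Z k))
    (f : forall k, hom (X k) (Y k)) s :
  tensm_seq (fun k => g k ∘ f k) s = tensm_seq g s ∘ tensm_seq f s.
Proof.
by elim: s => [|k s IH] /=; rewrite ?comp1m // IH tensm_comp.
Qed.

Lemma multicopyE A B (f : hom A B) s :
  multicopy f s = tensm_seq (fun=> f) s ∘ copy_seq A s.
Proof. by case: s => [|k s] //=; rewrite comp1m CM. Qed.

Lemma copy_cone A : is_cone (D := tens_diagram (fun _ : K => A)) (copy_seq A).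
Proof. by move=> F G GF; exact: marginal_copy. Qed.

Lemma tensm_cone X Y (f : forall k, hom (X k) (Y k)) L
    (p : fs_family (tens_diagram X) L) :
  is_cone p -> is_cone (D := tens_diagram Y) (fun F => tensm_seq f F ∘ p F).
Proof.
by move=> cp F G GF; rewrite /= compA marginal_nat -compA -(cp F G GF).
Qed.
End FiniteTensorMaps.

(** * Limits and Kolmogorov products *)

Section Limits.
Variables (C : cd_category) (K : choiceType).
Implicit Types (X : K -> C) (D : fs_diagram C K) (A L : C).

Lemma limit_ex D L (p : fs_family D L) A (f : fs_family D A) :
  is_limit p -> is_cone f -> exists g : hom A L, forall F, p F ∘ g = f F.
Proof. by move=> [_ lp] /lp [g [pg _]]; exists g. Qed.

Lemma limit_inj D L (p : fs_family D L) A (g h : hom A L) :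
  is_limit p -> (forall F, p F ∘ g = p F ∘ h) -> g = h.
Proof.
move=> [cp lp] gh.
have [F G GF|w [_ wu]] := lp A (fun F => p F ∘ h); first by rewrite compA cp.
by rewrite -(wu g) // -(wu h).
Qed.

Lemma limit_unique D L (p : fs_family D L) A (f : fs_family D A)
    (g : hom A L) : is_limit p -> (forall F, p F ∘ g = f F) ->
  unique (fun h => forall F, p F ∘ h = f F) g.
Proof.
by move=> lp pg; split=> // h ph; apply: limit_inj lp _ => F; rewrite pg ph.
Qed.

(** Preservation of the limit by tensoring, applied on either side, makes the
    maps [p F ⊠ p G] jointly monic.  The diagonal pairs [F = G] are enough,
    since both [p F] and [p G] are marginals of [p (F ∪ G)]. *)
Lemma kolmogorov_tens_inj X L (p : fs_family (tens_diagram X) L) A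
    (g h : hom A (L ⊗ L)) : kolmogorov_product p ->
  (forall F, (p F ⊠ p F) ∘ g = (p F ⊠ p F) ∘ h) -> g = h.
Proof.
move=> [[cp _] tp _] gh.
have gh2 F G : (p F ⊠ p G) ∘ g = (p F ⊠ p G) ∘ h.
  have := gh (F `|` G).
  move/(congr1 (fun m => (fs_map (tens_diagram X) (fsubsetUl F G) ⊠
    fs_map (tens_diagram X) (fsubsetUr F G)) ∘ m)).
  by rewrite !compA -!tensm_comp !cp.
(* First the right factor, then, after a braiding, the left one. *)
apply: (limit_inj (tp L)) => G; rewrite /family_tens.
have braid_inj (U V : C) (m n : hom A (U ⊗ V)) :
    braid U V ∘ m = braid U V ∘ n -> m = n.
  by apply: iso_mono; exists (braid V U); rewrite !braidK.
apply: (braid_inj); apply: (limit_inj (tp _)) => F; rewrite /family_tens.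
rewrite !compA -!braid_nat -!(compA (braid _ _)) !compA -!(compA (braid _ _)).
by rewrite -!tensm_comp comp1m compm1 gh2.
Qed.

(** Copyability of [g] is an equation between maps into [L ⊗ L], so it can be
    tested on the finite marginals. *)
Lemma kolmogorov_det X L (p : fs_family (tens_diagram X) L) A (g : hom A L) :
  markov C -> kolmogorov_product p ->
  (forall F, deterministic (p F ∘ g)) -> deterministic g.
Proof.
move=> CM kp dg; split; first exact: CM.
apply: (kolmogorov_tens_inj kp) => F; have [_ cg] := dg F.
have [_ _ dp] := kp; have [_ cp] := dp F.
by rewrite !compA -cp -compA cg tensm_comp.
Qed.

End Limits.

(** * Intersections of deterministic subobjects *)

Section Meets.
Variables (C : cd_category).
Implicit Types (A B E : C) (J : Type).

Definition below J A (D : J -> C) (i : forall x, hom (D x) A) B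
    (m : hom B A) :=
  forall x, exists t, i x ∘ t = m.

Definition is_meet J A (D : J -> C) (i : forall x, hom (D x) A) E
    (j : hom E A) :=
  [/\ det_mono j, below i j &
    forall B (m : hom B A), deterministic m -> below i m ->
      exists w, j ∘ w = m].

Definition has_meets J :=
  forall A (D : J -> C) (i : forall x, hom (D x) A),
    (forall x, det_mono (i x)) -> exists E (j : hom E A), is_meet i j.

Lemma has_meets_unit : has_meets unit.
Proof.
move=> A D i di; exists (D tt), (i tt); split=> //.
- by case; exists (idm _); rewrite compm1.
Qed.

(** A surjection with a chosen section [g] suffices: both families have the same
    lower bounds. *)
Lemma has_meets_surj J J' (f : J -> J') (g : J' -> J) :
  cancel g f -> has_meets J -> has_meets J'.
Proof.
move=> gK hJ A D i di.
have [E [j [dj bj gj]]] := hJ A (D \o f) (fun x => i (f x)) (fun x => di (f x)).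
exists E, j; split=> // [y|B m dm bm]; first by rewrite -(gK y); exact: bj.
by apply: gj => // x; exact: bm.
Qed.

(** Intersections can be formed in two stages; the legs of the inner ones are
    deterministic monomorphisms, so the outer one applies to them. *)
Lemma has_meets_sigma J (T : J -> Type) :
  has_meets J -> (forall x, has_meets (T x)) -> has_meets {x & T x}.
Proof.
move=> hJ hT A D i di.
have /choice[e me] : forall x, exists e : {E & hom E A},
    is_meet (fun y => i (existT T x y)) (projT2 e).
  move=> x; have [E [j mj]] :=
    hT x A _ (fun y => i (existT T x y)) (fun y => di _).
  by exists (existT _ E j).
have [E [j [dj bj gj]]] := hJ A _ (fun x => projT2 (e x))
  (fun x => let: And3 d _ _ := me x in d).
exists E, j; split=> // [[x y]|B m dm bm].
  have [t <-] := bj x; have [_ /(_ y)[s <-] _] := me x.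
  by exists (s ∘ t); rewrite compA.
by apply: gj => // x; have [_ _] := me x; apply=> // y; exact: bm.
Qed.

Lemma has_meets_tuple (K : choiceType) n :
  has_meets K -> has_meets (n.-tuple K).
Proof.
move=> hK; elim: n => [|n IH].
  apply: (@has_meets_surj _ _ (fun=> [tuple]) (fun=> tt)) has_meets_unit => t.
  by rewrite [RHS]tuple0.
apply: (@has_meets_surj {_ : K & n.-tuple K} _
  (fun x => [tuple of projT1 x :: projT2 x])
  (fun t => existT _ (thead t) [tuple of behead t])).
  by move=> t; rewrite [RHS]tuple_eta.
exact: has_meets_sigma.
Qed.

(** Every finite subset is enumerated by a tuple of some length, which reduces
    the claim to [K^n]-indexed intersections for all [n], followed by a
    countable one. *)
Lemma has_meets_fset (K : choiceType) :
  has_meets K -> has_meets nat -> has_meets {fset K}.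
Proof.
move=> hK hN.
refine (@has_meets_surj {n & n.-tuple K} {fset K}
  (fun x => [fset y in tval (projT2 x)])
  (fun F => existT (fun n => n.-tuple K) _ (in_tuple F)) _ _).
  by move=> F /=; apply/fsetP => y; rewrite !inE.
by apply: has_meets_sigma => // n; exact: has_meets_tuple.
Qed.

(** An infinite [K] contains a copy of the natural numbers, hence retracts onto
    them.  This avoids comparing the cardinals of [K] and of [{fset K}]. *)
Lemma has_meets_nat (K : choiceType) :
  (forall F : {fset K}, exists k, k \notin F) -> has_meets K -> has_meets nat.
Proof.
move=> /choice[new newP].
(* A sequence of distinct elements: [F n] collects its first n terms. *)
pose F n := iter n (fun F => new F |` F) fset0.
have newF m n : m < n -> new (F m) \in F n.
  elim: n => // n IH; rewrite ltnS leq_eqVlt => /orP[/eqP->|/IH mn].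
    exact: fset1U1.
  exact: fset1Ur.
have new_inj m n : new (F m) = new (F n) -> m = n.
  case: (ltngtP m n) => // /newF mn e; first rewrite e in mn.
    by case: (negP (newP _) mn).
  by rewrite -e in mn; case: (negP (newP _) mn).
have /choice[g gP] : forall k, exists n, forall m, new (F m) = k -> n = m.
  move=> k; case: (pselect (exists m, new (F m) = k)) => [[n <-]|nk].
    by exists n => m /new_inj.
  by exists 0 => m mk; case: nk; exists m.
by apply: (@has_meets_surj _ _ g (fun n => new (F n))) => n; exact: gP.
Qed.

End Meets.

(** * Infinite tensor products and intersections *)

Section KolmogorovMeets.
Variables (C : cd_category) (HC : partializable C) (K : choiceType).
Implicit Types (X Y : K -> C) (A B L : C).

Let CM : markov C := partializable_markov HC.

Lemma det_mono_seq X Y (i : forall k, hom (X k) (Y k)) s :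
  (forall k, det_mono (i k)) -> det_mono (tensm_seq i s).
Proof.
move=> di; elim: s => [|k s IH] /=; first exact: det_mono_id.
exact: det_mono_tens.
Qed.

Lemma infinite_tensor_ex X Y LX LY (pX : fs_family (tens_diagram X) LX)
    (pY : fs_family (tens_diagram Y) LY) (f : forall k, hom (X k) (Y k)) :
  kolmogorov_product pX -> kolmogorov_product pY ->
  exists g, infinite_tensor pX pY f g.
Proof.
move=> [[cX _] _ _] [lY _ _].
have [g pg] := limit_ex lY (tensm_cone CM f cX).
by exists g; exact: limit_unique.
Qed.

(** Monicity and determinism pass from the finite tensor products to the
    infinite one, as they can be tested after the projections. *)
Lemma infinite_tensor_det_mono X Y LX LY
    (pX : fs_family (tens_diagram X) LX) (pY : fs_family (tens_diagram Y) LY)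
    (i : forall k, hom (X k) (Y k)) iK :
  kolmogorov_product pX -> kolmogorov_product pY ->
  (forall k, det_mono (i k)) -> infinite_tensor pX pY i iK -> det_mono iK.
Proof.
move=> kX kY di [piK _]; split=> [|A g h gh].
  apply: (kolmogorov_det CM kY) => F; rewrite piK; apply: det_comp.
    by have [] := det_mono_seq F di.
  by case: kX => _ _; apply.
case: kX => lX _ _; apply: (limit_inj lX) => F.
apply: (det_mono_seq F di).2.
by rewrite !compA -piK -!compA gh.
Qed.

(** A map into the pullback of [⨂ i k] along the infinite copy of [A] is a map
    [m] to [A] together with maps [t k] to the [D k] such that [i k ∘ t k = m]
    for all [k].  Determinism of [m] enters because copying [m] must agree with
    applying [m] to every output of a copy. *)
Lemma has_meets_kolmogorov : has_kolmogorov_products C K -> has_meets C K.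
Proof.
move=> HK A D i di.
have [LA [pA kA]] := HK (fun=> A); have [LD [pD kD]] := HK D.
have [iK iKP] := infinite_tensor_ex i kD kA.
have diK := infinite_tensor_det_mono kD kA di iKP.
have [lA _ _] := kA; have [lD _ _] := kD; case: iKP => piK _.
have [c pc] := limit_ex lA (copy_cone CM A).
have [E [u [v [[uv pb] du]]]] := partializable_pullback HC c diK.
exists E, u; split=> // [k|B m dm bm].
  (* The [k]-th component of [v], read off from its [{k}]-marginal. *)
  have kk : k \in [fset k] by rewrite inE.
  exists (seq_proj D kk ∘ (pD _ ∘ v)).
  rewrite compA -(seq_proj_nat CM) -compA (compA (tensm_seq _ _)) -piK.
  rewrite -(compA (pA _)) -uv (compA (pA _)) pc compA (seq_proj_copy CM).
  by rewrite comp1m.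
have [t ti] := dependent_choice bm.
have [w pw] := limit_ex lD (tensm_cone CM t (copy_cone CM B)).
have [|h [[uh _] _]] := pb _ m w; last by exists h.
apply: (limit_inj lA) => F; rewrite !compA pc piK -compA pw compA.
rewrite (copy_seq_nat CM _ dm) -tensm_seq_comp; congr (_ ∘ _).
exact: eq_tensm_seq.
Qed.

End KolmogorovMeets.

(** * The order on partial morphisms *)

Section PartialOrder.
Variables (C : cd_category) (HC : partializable C).
Implicit Types (X Y Z : C).

Let CM : markov C := partializable_markov HC.

(** The span [f ⊗ (del ∘ g)] precomposed with [copy] is the restriction of [f]
    to the intersection of the two domains.  It equals [g] exactly when the
    domain of [g] is contained in that of [f] and the maps agree there. *)
Lemma le_span X Y (t s : span X Y) :
  le_hom (C := partial HC) (pclass t) (pclass s) <->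
  exists h : hom (span_dom t) (span_dom s),
    span_leg s ∘ h = span_leg t /\ span_map s ∘ h = span_map t.
Proof.
have -> : le_hom (C := partial HC) (pclass t) (pclass s) <->
    pcomp HC (pclass (Span (runit Y ∘ (span_map s ⊠ del (span_dom t)))
      (det_mono_tens HC (span_det_mono s) (span_det_mono t))))
      (incl (copy X)) = pclass t.
  rewrite /le_hom /= pcomp_incl ptensE pcomp_incl.
  by rewrite (pclass_congr _
    (det_mono_tens HC (span_det_mono s) (span_det_mono t)) erefl
    (congr1 (fun m => _ ∘ (_ ⊠ m)) (CM _))).
case: s => A i f di; case: t => B j g dj /=; split=> [|[h [ih fh]]].
  have [r cr] := span_composite_ex HC (Span (copy X) (det_mono_id X))
    (Span (runit Y ∘ (f ⊠ del B)) (det_mono_tens HC di dj)).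
  rewrite (pcompE HC cr) => /eq_pclass/span_equiv_sym[k [_ lk mk]].
  case: cr => u [v [[/= uv _] lr mr]]; exists (tproj1 A B ∘ v ∘ k); split.
    rewrite 2!compA -(tproj1_nat CM i j) -(compA (tproj1 X X)) -uv compA.
    by rewrite tproj1_copy -lr lk.
  by rewrite -[RHS]mk mr /= runit_del 2!compA.
(* Conversely, when [j] factors through [i], the pullback of [i ⊠ j] along
   [copy] is [j] itself, with second projection the pairing of [h] and [idm]. *)
have e : copy X ∘ j = (i ⊠ j) ∘ ((h ⊠ idm B) ∘ copy B).
  by rewrite compA -tensm_comp ih compm1 dj.1.2.
apply: pcompE; exists j, ((h ⊠ idm B) ∘ copy B); split=> /=; last 2 first.
- by rewrite comp1m.
- rewrite runit_del compA -(compA f) (tproj1_nat CM) compA fh -compA.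
  by rewrite tproj1_copy compm1.
split=> // S a b ab.
have jb : j ∘ (tproj2 A B ∘ b) = a.
  rewrite compA -(tproj2_nat CM i) -compA -ab compA.
  by rewrite tproj2_copy comp1m.
exists (tproj2 A B ∘ b); split; first split=> //.
  apply: (det_mono_tens HC di dj).2.
  by rewrite compA -e -compA jb.
by move=> k [jk _]; apply: dj.2; rewrite jb jk.
Qed.

(** Maps into the domain of a composite of spans are pairs of maps, by the
    universal property of the defining pullback. *)
Lemma le_span_comp X Y Z (s : span X Y) (r : span Y Z) (t : span X Z) :
  le_hom (C := partial HC) (pclass t) (pcomp HC (pclass r) (pclass s)) <->
  exists (a : hom (span_dom t) (span_dom s)) (b : hom (span_dom t) (span_dom r)),
    [/\ span_leg s ∘ a = span_leg t, span_map s ∘ a = span_leg r ∘ b &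
        span_map r ∘ b = span_map t].
Proof.
have [q cq] := span_composite_ex HC s r; rewrite (pcompE HC cq) le_span.
case: cq => u [v [pb lq mq]]; split=> [[h [lh mh]]|[a [b [sa sr rb]]]].
  exists (u ∘ h), (v ∘ h); split; first by rewrite compA -lq.
    by rewrite !compA pb.1.
  by rewrite compA -mq.
have [h [[uh vh] _]] := pb.2 _ _ _ sr.
by exists h; rewrite lq mq -!compA uh vh.
Qed.

Lemma incl_deterministic X Y (f : hom X Y) :
  deterministic f -> deterministic (C := partial HC) (incl f).
Proof.
move=> [tf cf]; split; rewrite /total /copyable /= ?incl_tens -!incl_comp.
  by rewrite tf.
by rewrite cf.
Qed.

(** The structure maps of [Partial C] are images of those of [C]; this persists
    for everything built from them. *)

Section Sequences.
Variable K : choiceType.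
Implicit Types (U V : K -> C) (k : K) (s t : seq K).

Lemma partial_hom_eq U k l (e : k = l) :
  hom_eq (C := partial HC) U e = incl (hom_eq (C := C) U e).
Proof. by case: l / e. Qed.

Lemma partial_to_front U k s (ks : k \in s) :
  to_front (C := partial HC) U ks = incl (to_front (C := C) U ks).
Proof.
elim: s ks => [|l s IH] ks //=.
move: (mem_behead ks) (@eqP _ l k).
move: (l == k) => [] mb lk /=.
  rewrite -incl_tens; congr (ptens _ _ _).
  exact: partial_hom_eq.
by rewrite IH /swap_front /= !incl_tens -!incl_comp.
Qed.

Lemma partial_marginal U t s (ts : uniq_sub t s) :
  marginal (C := partial HC) U ts = incl (marginal (C := C) U ts).
Proof.
elim: t s ts => [|k t IH] s ts //=.
by rewrite IH partial_to_front incl_tens -incl_comp.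
Qed.

Lemma partial_copy_seq X s :
  copy_seq (C := partial HC) X s = incl (copy_seq (C := C) X s).
Proof. by elim: s => [|k s IH] //=; rewrite IH incl_tens -incl_comp. Qed.

Lemma partial_tensm_seq U V (u : forall k, span (U k) (V k)) s
    (ds : det_mono (tensm_seq (fun k => span_leg (u k)) s)) :
  tensm_seq (C := partial HC) (fun k => pclass (u k)) s =
  pclass (Span (tensm_seq (fun k => span_map (u k)) s) ds).
Proof.
elim: s ds => [|k s IH] ds /=; first exact: pclass_congr.
have ds' := det_mono_seq HC s (fun k => span_det_mono (u k)).
by rewrite (IH ds') ptensE; exact: pclass_congr.
Qed.

End Sequences.
End PartialOrder.

(** * Lax Kolmogorov products of partial morphisms *)

Section LaxKolmogorov.
Variables (C : cd_category) (HC : partializable C) (K : choiceType).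
Hypothesis HK : has_kolmogorov_products C K.
Implicit Types (X Y : K -> C) (A B L : C).

Let CM : markov C := partializable_markov HC.

(** A finite [K] needs a separate argument, as countable intersections are only
    obtained for infinite [K]; there the family has a smallest member. *)
Lemma lax_cone_meet A (D : {fset K} -> C) (i : forall F, hom (D F) A) :
  (forall F, det_mono (i F)) ->
  (forall F G, G `<=` F -> exists t, i G ∘ t = i F) ->
  exists E (j : hom E A), is_meet i j.
Proof.
move=> di mono_i.
have [[F FT]|fin] := pselect (exists F : {fset K}, forall k, k \in F).
  exists (D F), (i F); split=> [|G|B m _ /(_ F)] //.
  by apply: mono_i; apply/fsubsetP => k _.
apply: has_meets_fset => //; first exact: has_meets_kolmogorov.
apply: has_meets_nat (has_meets_kolmogorov _ HK) => // F.
apply: contrapT => nF; apply: fin; exists F => k.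
by apply: contrapT => /negP kF; apply: nF; exists k.
Qed.

(** The diagram [m] and the family [q] are only required to agree pointwise with
    images from [C], so that the lemma applies to the marginalizations of
    [Partial C], which are not syntactically such images.

    The greatest partial morphism is defined on the intersection of the domains
    of the lax cone, where the cone becomes strict. *)
Lemma limit_lax_limit (D : fs_diagram C K) L (p : fs_family D L)
    (m : forall F G, G `<=` F ->
      hom (c := partial HC) (fs_ob D F) (fs_ob D G))
    (q : fs_family (C := partial HC) (FsDiagram m) L) :
  (forall F G (GF : G `<=` F), m F G GF = incl (fs_map D GF)) ->
  (forall F, q F = incl (p F)) ->
  is_limit p -> is_lax_limit q.
Proof.
move=> mE qE lp; have [cp _] := lp; split=> [F G GF|A f cf].
  rewrite /= mE !qE -incl_comp cp; exact: (pquasi_total HC (incl (p G))).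
have [s fs] := dependent_choice (fun F => pclassP (f F)).
have cs F G (GF : G `<=` F) : exists h : hom (span_dom (s F)) (span_dom (s G)),
    span_leg (s G) ∘ h = span_leg (s F) /\
    span_map (s G) ∘ h = fs_map D GF ∘ span_map (s F).
  have := cf F G GF; rewrite /= mE !fs pcomp_incl.
  by move=> /(le_span HC).
have [F|F G GF|E [j [dj bj gj]]] := lax_cone_meet (i := fun F => span_leg (s F)).
- exact: span_det_mono.
- by have [h [lh _]] := cs F G GF; exists h.
have [t tj] := dependent_choice bj.
have [F G GF|h ph] := limit_ex (f := fun F => span_map (s F) ∘ t F) lp.
  have [w [lw mw]] := cs F G GF; rewrite /= compA -mw -compA; congr (_ ∘ _).
  by apply: (span_det_mono (s G)).2; rewrite compA lw !tj.
exists (pclass (Span h dj)); split=> [F|g' qg'].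
  rewrite qE fs /= pcomp_incl; apply/(le_span HC).
  by exists (t F); rewrite tj ph.
have [r e] := pclassP g'; subst g'; apply/(le_span HC) => /=.
have v F : exists v, span_leg (s F) ∘ v = span_leg r /\
    span_map (s F) ∘ v = p F ∘ span_map r.
  by have := qg' F; rewrite qE fs /= pcomp_incl => /(le_span HC).
have [F|w jw] := gj _ (span_leg r) (span_det_mono r).1.
  by have [x [lx _]] := v F; exists x.
exists w; split=> //; apply: (limit_inj lp) => F.
have [x [lx <-]] := v F; rewrite compA ph -compA; congr (_ ∘ _).
by apply: (span_det_mono (s F)).2; rewrite compA tj jw lx.
Qed.

Lemma incl_lax_kolmogorov X L (p : fs_family (tens_diagram X) L) :
  kolmogorov_product p -> lax_kolmogorov_product (incl_family HC p).
Proof.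
move=> [lp tp dp]; split=> [|F]; last exact: (incl_deterministic HC (dp F)).
split=> [|A].
  by apply: (limit_lax_limit _ _ lp) => // F G GF; exact: partial_marginal.
apply: (limit_lax_limit _ _ (tp A)) => [F G GF|F] /=; last exact: incl_tens.
by rewrite partial_marginal incl_tens.
Qed.

(** The partial morphism [u^F ∘ π_F] has as domain the pullback of [π_F] along
    [⨂_(k in F) i k].  A partial morphism below all of them is thus given by a
    leg [j : B -> X^K] with maps [v F] from [B] to the finite tensor products of
    the [D k], and these assemble to a map from [B] to the infinite one. *)
Lemma lax_induced_tensor X Y (u : forall k, span (X k) (Y k)) XK DK YK
    (pX : fs_family (tens_diagram X) XK)
    (pD : fs_family (tens_diagram (fun k => span_dom (u k))) DK)
    (pY : fs_family (tens_diagram Y) YK) :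
  kolmogorov_product pX -> kolmogorov_product pD -> kolmogorov_product pY ->
  let uX : fs_family (C := partial HC) (tens_diagram (C := partial HC) Y) XK :=
    fun F => tensm_seq (C := partial HC) (fun k => pclass (u k)) F ∘
             incl_family HC pX F in
  is_lax_cone uX /\
  exists (iK : hom DK XK) (fK : hom DK YK),
    [/\ infinite_tensor pD pX (fun k => span_leg (u k)) iK,
        infinite_tensor pD pY (fun k => span_map (u k)) fK &
        exists dK : det_mono iK,
          lax_induced (incl_family HC pY) uX (pclass (Span fK dK))].
Proof.
move=> kX kD kY uX.
have ds F := det_mono_seq HC F (fun k => span_det_mono (u k)).
have uXE F : uX F = pcomp HC (pclass (Span (tensm_seq (fun k => span_map (u k)) F)
    (ds F))) (incl (pX F)).
  by rewrite /uX (partial_tensm_seq HC (ds F)).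
split=> [F G GF|].
  have [r cr] := span_composite_ex HC (Span (pX F) (det_mono_id XK))
    (Span (tensm_seq (fun k => span_map (u k)) F) (ds F)).
  rewrite uXE /= partial_marginal uXE (pcompE HC cr) pcomp_incl.
  apply/(le_span_comp HC) => /=; have [[cX _] _ _] := kX.
  case: cr => a [b [[/= ab _] lr mr]].
  exists a, (marginal _ (uniq_sub_fset GF) ∘ b); split=> //=.
  - rewrite -(cX F G GF) /= -compA ab !compA; congr (_ ∘ _).
    by rewrite (marginal_nat CM).
  - rewrite mr /= !compA; congr (_ ∘ _); by rewrite (marginal_nat CM).
have [iK tiK] := infinite_tensor_ex HC (fun k => span_leg (u k)) kD kX.
have [fK tfK] := infinite_tensor_ex HC (fun k => span_map (u k)) kD kY.
have dK := infinite_tensor_det_mono HC kD kX (fun k => span_det_mono (u k)) tiK.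
exists iK, fK; split=> //; exists dK; case: tiK => piK _; case: tfK => pfK _.
have [lX _ _] := kX; have [lD _ _] := kD; have [lY _ _] := kY.
split=> [F|g' le_g'].
  rewrite uXE /= pcomp_incl; apply/(le_span_comp HC) => /=.
  by exists iK, (pD F); rewrite comp1m piK pfK.
have [r e] := pclassP g'; subst g'; apply/(le_span HC) => /=.
have /dependent_choice[v vP] : forall F : {fset K},
    exists v : hom (span_dom r) (tens_seq (fun k => span_dom (u k)) F),
    tensm_seq (fun k => span_leg (u k)) F ∘ v = pX F ∘ span_leg r /\
    tensm_seq (fun k => span_map (u k)) F ∘ v = pY F ∘ span_map r.
  move=> F; have := le_g' F.
  rewrite uXE /= pcomp_incl => /(le_span_comp HC)[a [b [/=]]].
  by rewrite comp1m => <- lb mb; exists b.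
have lv F := (vP F).1; have mv F := (vP F).2.
(* The [v F] form a cone, as may be checked after the monic legs. *)
have [F G GF|w pw] :=
  limit_ex (D := tens_diagram (fun k => span_dom (u k))) (f := v) lD.
  apply: (ds G).2; rewrite lv /= compA -(marginal_nat CM) -compA lv compA.
  by have [cX _] := lX; rewrite -(cX F G GF).
exists w; split.
  by apply: (limit_inj lX) => F; rewrite compA piK -compA pw lv.
by apply: (limit_inj lY) => F; rewrite compA pfK -compA pw mv.
Qed.

(** Determinism of the leg [i] lets the square over the iterated copy commute;
    it is a pullback because any one factor recovers the map to [D]. *)
Lemma partial_multicopy (X Y : C) (u : span X Y) (s : seq K) :
  multicopy (C := partial HC) (pclass u) s =
  pclass (Span (multicopy (span_map u) s) (span_det_mono u)).
Proof.
case: s => [|k s]; first exact: pcomp_incl.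
have ds := det_mono_seq HC (k :: s) (fun _ : K => span_det_mono u).
rewrite [LHS]/multicopy (partial_tensm_seq _ ds) partial_copy_seq.
have cu := copy_seq_nat CM (k :: s) (span_det_mono u).1.
apply: (pcompE HC); exists (span_leg u), (copy_seq _ (k :: s)).
split=> //; last by rewrite comp1m.
split=> // S a b ab.
have kk : k \in k :: s by rewrite inE eqxx.
have uS : span_leg u ∘ (seq_proj (fun=> span_dom u) kk ∘ b) = a.
  rewrite compA -(seq_proj_nat CM (fun=> span_leg u)) -compA -ab compA.
  by rewrite (seq_proj_copy CM) comp1m.
exists (seq_proj (fun=> span_dom u) kk ∘ b); split; first split=> //.
  by apply: ds.2; rewrite compA -[X in X ∘ _]cu -compA uS ab.
by move=> h [uh _]; apply: (span_det_mono u).2; rewrite uS uh.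
Qed.

Lemma infinite_copy_span (X Y : C) (u : span X Y) YK
    (pY : fs_family (tens_diagram (fun _ : K => Y)) YK) :
  kolmogorov_product pY ->
  exists fK : hom (span_dom u) YK,
    infinite_copy pY (span_map u) fK /\
    infinite_copy (C := partial HC) (incl_family HC pY) (pclass u)
      (pclass (Span fK (span_det_mono u))).
Proof.
move=> [lY _ _].
have [fK pfK] := limit_ex lY
  (tensm_cone CM (fun=> span_map u) (copy_cone CM (span_dom u))).
have {}pfK F : pY F ∘ fK = multicopy (span_map u) F.
  by rewrite pfK (multicopyE CM).
exists fK; split; first exact: limit_unique.
split=> [F|h ph].
  rewrite partial_multicopy /= pcomp_incl.
  exact: (pclass_congr _ _ erefl (pfK F)).
have [r e] := pclassP h; subst h; apply: pclass_eq.
have uv F : exists v, [/\ is_iso v, span_leg r ∘ v = span_leg u &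
    pY F ∘ span_map r ∘ v = multicopy (span_map u) F].
  have := ph F; rewrite partial_multicopy /= pcomp_incl => /esym/eq_pclass.
  by move=> [v [iv lv mv]]; exists v.
(* The leg is monic, so the isomorphisms obtained for the various [F] all
   coincide with the one for the empty set. *)
have [v [iv lv _]] := uv fset0; exists v; split=> //.
apply: (limit_inj lY) => F; have [w [_ lw mw]] := uv F.
rewrite pfK -mw compA; congr (_ ∘ _).
by apply: (span_det_mono r).2; rewrite lv lw.
Qed.

End LaxKolmogorov.

Theorem proposition1p17 (K : choiceType) (C : cd_category)
    (HC : partializable C) (HK : has_kolmogorov_products C K) :
  (forall (X : K -> C) (XK : C) (pX : fs_family (tens_diagram X) XK),
     kolmogorov_product pX ->
     lax_kolmogorov_product (incl_family HC pX))
  /\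
  (forall (X Y : K -> C) (u : forall k, span (X k) (Y k))
     (XK DK YK : C)
     (pX : fs_family (tens_diagram X) XK)
     (pD : fs_family (tens_diagram (fun k => span_dom (u k))) DK)
     (pY : fs_family (tens_diagram Y) YK),
     kolmogorov_product pX -> kolmogorov_product pD -> kolmogorov_product pY ->
     let uX : fs_family (C := partial HC) (tens_diagram (C := partial HC) Y) XK :=
       fun F => tensm_seq (C := partial HC) (fun k => pclass (u k)) F ∘
                incl_family HC pX F in
     is_lax_cone uX /\
     exists (iK : hom DK XK) (fK : hom DK YK),
       [/\ infinite_tensor pD pX (fun k => span_leg (u k)) iK,
           infinite_tensor pD pY (fun k => span_map (u k)) fK &
           exists dK : det_mono iK,
             lax_induced (incl_family HC pY) uX (pclass (Span fK dK))])
  /\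
  (forall (X Y : C) (u : span X Y) (YK : C)
     (pY : fs_family (tens_diagram (fun _ : K => Y)) YK),
     kolmogorov_product pY ->
     exists fK : hom (span_dom u) YK,
       infinite_copy pY (span_map u) fK /\
       infinite_copy (C := partial HC) (incl_family HC pY) (pclass u)
         (pclass (Span fK (span_det_mono u)))).
Proof.
split; first by move=> X XK pX; exact: incl_lax_kolmogorov.
split; last by move=> X Y u YK pY; exact: infinite_copy_span.
by move=> X Y u XK DK YK pX pD pY; exact: lax_induced_tensor.
Qed.
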